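(* The subspace $c_0$ is not complemented in $ac_0$; that is, there is no bounded linear operator $P: ac_0 \to c_0$ such that $Px = x$ for every $x \in c_0$.
   Context: $\mathbb{N}$ is the set of positive integers. $\ell_\infty$ is the space of all bounded real sequences $x=(x_1,x_2,\ldots)$ with the norm $\|x\| = \sup_{n\in\mathbb{N}} |x_n|$, and $c_0\subset \ell_\infty$ is the subspace of sequences converging to zero. A Banach limit is a linear functional $B\in\ell_\infty^*$ such that (i) $Bx\ge 0$ whenever $x\ge 0$ (coordinatewise), (ii) $B\mathbb{I}=1$, where $\mathbb{I}=(1,1,\ldots)$, and (iii) $B(Tx)=Bx$ for all $x\in\ell_\infty$, where $T(x_1,x_2,\ldots)=(x_2,x_3,\ldots)$ is the shift operator. A sequence $x\in\ell_\infty$ is almost convergent to $t\in\mathbb{R}$ if $Bx=t$ for every Banach limit $B$. $ac_0$ denotes the set of all sequences almost convergent to $0$; it is a linear subspace of $\ell_\infty$ containing $c_0$, endowed with the norm of $\ell_\infty$. *)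

(* Defs.v *)
From HB Require Import structures.
From mathcomp Require Import all_boot all_order all_algebra.
From mathcomp Require Import all_classical all_reals all_analysis.

Set Implicit Arguments.
Unset Strict Implicit.
Unset Printing Implicit Defensive.

Import Order.TTheory GRing.Theory Num.Theory.
Import numFieldNormedType.Exports.

Local Open Scope classical_set_scope.
Local Open Scope ring_scope.

Section NormedSubspace.
Variables (K : numFieldType) (V : normedModType K) (S : submodClosed V).

(* A linear subspace [S] of a normed space, as a normed space of its own with
   the induced norm. *)
Record subspace_of := Subspace {
  subspace_val : V;
  _ : subspace_val \in S
}.

HB.instance Definition _ := [isSub for subspace_val].
HB.instance Definition _ := [Choice of subspace_of by <:].
HB.instance Definition _ := [SubChoice_isSubLmodule of subspace_of by <:].

Lemma subspace_norm_triangle (x y : subspace_of) :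
  `|val (x + y)| <= `|val x| + `|val y|.
Proof. exact: ler_normD. Qed.

Lemma subspace_normZ (a : K) (x : subspace_of) :
  `|val (a *: x)| = `|a| * `|val x|.
Proof. by rewrite linearZ normrZ. Qed.

Lemma subspace_norm0_eq0 (x : subspace_of) : `|val x| = 0 -> x = 0.
Proof. by move=> /normr0_eq0 x0; exact: val_inj. Qed.

HB.instance Definition _ := Lmodule_isNormed.Build K subspace_of
  subspace_norm_triangle subspace_normZ subspace_norm0_eq0.

End NormedSubspace.

Section Linfty.
Variable R : realType.

Definition linfty_pred : {pred nat -> R} :=
  mem [set u : nat -> R | bounded_fun u].

Lemma linfty_predP (u : nat -> R) :
  u \in linfty_pred <-> exists M, forall n, `|u n| <= M.
Proof.
rewrite /linfty_pred; split=> [/set_mem[M [_ uM]]|[M uM]].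
  by exists (M + 1) => n; apply: uM => //; rewrite ltrDl.
apply/mem_set; exists M; split => [|N MN n _ /=]; first exact: num_real.
exact: le_trans (uM n) (ltW MN).
Qed.

Lemma linfty_submod_closed : submod_closed linfty_pred.
Proof.
split; first by apply/linfty_predP; exists 0 => n; rewrite normr0.
move=> a u v /linfty_predP[M uM] /linfty_predP[N vN].
apply/linfty_predP; exists (`|a| * M + N) => n.
apply: le_trans (ler_normD _ _) _.
by rewrite normrM lerD// ler_wpM2l.
Qed.

HB.instance Definition _ :=
  GRing.isSubmodClosed.Build _ _ linfty_pred linfty_submod_closed.

(* Sequences are indexed from 0: [x n] is x_{n+1} in 1-based notation. *)
Record linfty := Linfty {
  linfty_val :> nat -> R;
  _ : linfty_val \in linfty_pred
}.

HB.instance Definition _ := [isSub for linfty_val].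
HB.instance Definition _ := [Choice of linfty by <:].
HB.instance Definition _ := [SubChoice_isSubLmodule of linfty by <:].

Definition linfty_norm (x : linfty) : R := sup (range (fun n => `|x n|)).

Lemma linfty_has_sup (x : linfty) : has_sup (range (fun n => `|x n|)).
Proof.
split; first by exists `|x 0%N|, 0%N.
have /linfty_predP[M xM] := valP x.
by exists M => _ [n _ <-]; exact: xM.
Qed.

Lemma linfty_norm_ub (x : linfty) n : `|x n| <= linfty_norm x.
Proof. by apply: sup_upper_bound; [exact: linfty_has_sup|exists n]. Qed.

Lemma linfty_norm_le (x : linfty) M :
  (forall n, `|x n| <= M) -> linfty_norm x <= M.
Proof.
move=> xM; apply: ge_sup => [|_ [n _ <-]]; last exact: xM.
exact: (linfty_has_sup x).1.
Qed.

Lemma linfty_norm_triangle (x y : linfty) :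
  linfty_norm (x + y) <= linfty_norm x + linfty_norm y.
Proof.
apply: linfty_norm_le => n; apply: le_trans (ler_normD _ _) _.
by rewrite lerD// linfty_norm_ub.
Qed.

Lemma linfty_normZ (a : R) (x : linfty) :
  linfty_norm (a *: x) = `|a| * linfty_norm x.
Proof.
have le_normZ b (y : linfty) : linfty_norm (b *: y) <= `|b| * linfty_norm y.
  apply: linfty_norm_le => n.
  by rewrite [X in X <= _]normrM ler_wpM2l// linfty_norm_ub.
apply/eqP; rewrite eq_le le_normZ/=.
have [->|a0] := eqVneq a 0.
  rewrite normr0 mul0r; exact: le_trans (normr_ge0 _) (linfty_norm_ub _ 0%N).
rewrite -ler_pdivlMl ?normr_gt0// -normfV.
by rewrite (le_trans _ (le_normZ _ _))// scalerA mulVf// scale1r.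
Qed.

Lemma linfty_norm0_eq0 (x : linfty) : linfty_norm x = 0 -> x = 0.
Proof.
move=> x0; apply/val_inj/funext => n; apply/eqP.
by rewrite -normr_le0 -x0 linfty_norm_ub.
Qed.

HB.instance Definition _ := Lmodule_isNormed.Build R linfty
  linfty_norm_triangle linfty_normZ linfty_norm0_eq0.

Lemma linfty_cst_subproof (a : R) : (fun=> a) \in linfty_pred.
Proof. by apply/linfty_predP; exists `|a|. Qed.

Definition linfty1 : linfty := Linfty (linfty_cst_subproof 1).

Lemma linfty_shift_subproof (x : linfty) : (fun n => x n.+1) \in linfty_pred.
Proof.
have /linfty_predP[M xM] := valP x.
by apply/linfty_predP; exists M => n; exact: xM.
Qed.

Definition linfty_shift (x : linfty) : linfty :=
  Linfty (linfty_shift_subproof x).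

Definition Banach_limit (B : {linear linfty -> R^o}) : Prop :=
  [/\ bounded_fun_norm B,
      forall x : linfty, (forall n, 0 <= x n) -> 0 <= B x,
      B linfty1 = 1 &
      forall x : linfty, B (linfty_shift x) = B x].

Definition almost_convergent (x : linfty) (t : R) : Prop :=
  forall B : {linear linfty -> R^o}, Banach_limit B -> B x = t.

Definition c0_pred : {pred linfty} :=
  mem [set x : linfty | x n @[n --> \oo] --> 0].

Lemma c0_submod_closed : submod_closed c0_pred.
Proof.
split; first by apply/mem_set; exact: cvg_cst.
move=> a x y /set_mem/= x0 /set_mem/= y0; apply/mem_set => /=.
rewrite -[X in _ --> X](addr0 0) -[X in _ --> X + _](mulr0 a).
by apply: cvgD => //; apply: cvgMr.
Qed.

HB.instance Definition _ :=
  GRing.isSubmodClosed.Build _ _ c0_pred c0_submod_closed.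

Definition ac0_pred : {pred linfty} :=
  mem [set x : linfty | almost_convergent x 0].

Lemma ac0_submod_closed : submod_closed ac0_pred.
Proof.
split; first by apply/mem_set => B _; rewrite linear0.
move=> a x y /set_mem/= x0 /set_mem/= y0; apply/mem_set => B BL.
by rewrite linearP x0// y0// scaler0 addr0.
Qed.

HB.instance Definition _ :=
  GRing.isSubmodClosed.Build _ _ ac0_pred ac0_submod_closed.

Definition c0 := subspace_of c0_pred.
HB.instance Definition _ := NormedModule.on c0.

Definition ac0 := subspace_of ac0_pred.
HB.instance Definition _ := NormedModule.on ac0.

Lemma c0_sub_ac0 : {subset c0_pred <= ac0_pred}.
Proof.
move=> x /set_mem/= x0; apply/mem_set => B [_ Bge0 B1 BT].
have B_iter N (y : linfty) : B (iter N linfty_shift y) = B y.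
  by elim: N => //= N <-; rewrite BT.
have iterE N (y : linfty) n : iter N linfty_shift y n = y (n + N)%N.
  by elim: N n => [|N IH] n /=; rewrite ?addn0// IH addSnnS.
have B_le e (y : linfty) : (forall n, y n <= e) -> B y <= e.
  move=> ye; have Be : B (e *: linfty1) = e by rewrite linearZ/= B1 [LHS]mulr1.
  rewrite -subr_ge0 -{1}Be -linearB; apply: Bge0 => n.
  have -> : (e *: linfty1 - y) n = e * 1 - y n by [].
  by rewrite mulr1 subr_ge0.
apply/eqP; rewrite -normr_le0; apply/ler_addgt0Pl => e e0; rewrite addr0.
have /cvgrPdist_le/(_ _ e0)[N _ xN] := x0.
have {}xN n : `|iter N linfty_shift x n| <= e.
  have := xN (n + N)%N (leq_addl _ _); rewrite /= sub0r normrN.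
  by rewrite -iterE.
rewrite -(B_iter N) ler_norml lerNl -linearN.
apply/andP; split; apply: B_le => n.
  have -> : (- iter N linfty_shift x) n = - iter N linfty_shift x n by [].
  by apply: le_trans (xN n); rewrite -normrN ler_norm.
exact: le_trans (ler_norm _) (xN n).
Qed.

Definition c0_ac0 (x : c0) : ac0 := Subspace (c0_sub_ac0 (valP x)).

Lemma c0_ac0E (x : c0) : subspace_val (c0_ac0 x) = subspace_val x.
Proof. by rewrite /c0_ac0 /=; case: x. Qed.

End Linfty.

(* Main.v *)
Require Import Defs.
From HB Require Import structures.
From mathcomp Require Import all_boot all_order all_algebra.
From mathcomp Require Import all_classical all_reals all_analysis.
From mathcomp Require Import zify.

Set Implicit Arguments.
Unset Strict Implicit.
Unset Printing Implicit Defensive.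

Import Order.TTheory GRing.Theory Num.Theory.
Import numFieldNormedType.Exports.

(** The argument is Whitley's proof that [c0] is not complemented in [linfty],
    run inside [ac0].

    To a binary sequence [t] attach the set [prefix_set t] of the numbers
    [1 t_0 t_1 ... t_(k-1)] written in base two, one for each [k].  This gives
    uncountably many infinite sets, and two of them meet in a finite set only.
    Each set is so sparse (an element is at least twice any smaller one) that
    for every [N] the window [[n, n + N[] contains at most one of its elements
    once [n >= N].  So a Banach limit of its indicator sequence is at most
    [1 / N] for every [N], and the indicator lies in [ac0]: this is
    [lacunary_ac0].

    Let [P] be a bounded projection of [ac0] onto [c0].  For each [n] the
    functional [f : x |-> x n - (P x) n] is bounded and vanishes on [c0].  For
    distinct indicators [a_1, ..., a_m] of the family, the combination
    [\sum_i sg (f a_i) a_i] has entries of absolute value at most 1 off a finite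
    set of coordinates, which [f] ignores, so [\sum_i |f a_i|] is bounded
    independently of [m] ([functional_sum_bound]).  Therefore [f] is nonzero on
    countably many indicators only ([functional_support_countable]).  Taking the
    union over [n], some indicator [a] has [a n = (P a) n] for all [n]; then
    [a = P a] tends to 0, which is absurd because [prefix_set t] is infinite. *)

Local Open Scope classical_set_scope.
Local Open Scope ring_scope.

(** * A family of sparse, almost disjoint sets of integers *)

(** Each element is at least twice any smaller one. *)
Definition lacunary (A : pred nat) : Prop :=
  forall a b, A a -> A b -> (a < b)%N -> (2 * a <= b)%N.

(** Any two distinct members of the family have finite intersection: no common
    element from some bound on. *)
Definition almost_disjoint (I : eqType) (A : I -> pred nat) : Prop :=
  forall i j, i != j -> exists N, forall n, (N <= n)%N -> ~~ (A i n && A j n).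

(** The number whose binary expansion is a leading 1 followed by the first [k]
    digits of [t]. *)
Fixpoint prefix_code (t : nat -> bool) (k : nat) : nat :=
  if k is k'.+1 then (2 * prefix_code t k' + t k')%N else 1%N.

(** The set of codes of the prefixes of [t].  A code has as many digits after
    its leading one as its binary logarithm, so the length of the candidate
    prefix can be read off [n]. *)
Definition prefix_set (t : nat -> bool) : pred nat :=
  fun n => n == prefix_code t (trunc_log 2 n).

Lemma prefix_code_bounds t k : (2 ^ k <= prefix_code t k < 2 ^ k.+1)%N.
Proof.
elim: k => [|k IH] //=; move: IH; rewrite !expnS.
by case: (t k) => /=; lia.
Qed.

Lemma trunc_log_prefix_code t k : trunc_log 2 (prefix_code t k) = k.
Proof. by apply: trunc_log_eq => //; exact: prefix_code_bounds. Qed.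

Lemma prefix_set_code t k : prefix_set t (prefix_code t k).
Proof. by rewrite /prefix_set trunc_log_prefix_code. Qed.

Lemma prefix_code_double t k d :
  (2 * prefix_code t k <= prefix_code t (k + d.+1))%N.
Proof.
elim: d => [|d IH]; first by rewrite addn1 /= leq_addr.
by rewrite addnS /=; apply: leq_trans IH _; lia.
Qed.

Lemma lacunary_prefix_set t : lacunary (prefix_set t).
Proof.
move=> a b /eqP -> /eqP ->.
move: (trunc_log 2 a) (trunc_log 2 b) => k l ltkl.
have [ltkl'|lelk] := ltnP k l.
  by have := prefix_code_double t k (l - k.+1); rewrite addnS -addSn subnKC.
have [ltlk|lekl] := ltnP l k.
  have := prefix_code_double t l (k - l.+1).
  by rewrite addnS -addSn subnKC //; lia.
by move: ltkl; rewrite (@anti_leq k l) ?lekl ?lelk// ltnn.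
Qed.

(** The code of a prefix determines the codes of all shorter prefixes. *)
Lemma prefix_code_inj s t k d :
  prefix_code s (k + d) = prefix_code t (k + d) ->
  prefix_code s k = prefix_code t k.
Proof.
elim: d => [|d IH]; first by rewrite addn0.
by rewrite addnS /= => e; apply: IH; case: (s _) (t _) e => [] []; lia.
Qed.

Lemma almost_disjoint_prefix_set : almost_disjoint prefix_set.
Proof.
move=> s t /eqP st; have [k stk] : exists k, s k <> t k.
  by apply/existsNP => stE; apply/st/funext.
exists (2 ^ k.+1)%N => n len; apply/negP => /andP[/eqP ns /eqP nt].
apply: stk; have lek : (k < trunc_log 2 n)%N by rewrite trunc_log_max.
have := @prefix_code_inj s t k.+1 (trunc_log 2 n - k.+1).
rewrite subnKC// -ns -nt => /(_ erefl) /=.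
by case: (s k) (t k) => [] [] //; lia.
Qed.

(** Cantor's diagonal argument. *)
Lemma uncountable_binary_sequences : ~ countable [set: nat -> bool].
Proof.
move=> /pcard_surjP[g gsurj].
have [n _ gn] := gsurj (fun n => ~~ g n n) I.
by have := congr1 (@^~ n) gn; case: (g n n).
Qed.

(** A sum with at most one nonzero term, of absolute value at most 1. *)
Lemma norm_sum_le1 (R : realDomainType) (I : eqType) (s : seq I) (F : I -> R) :
  uniq s -> (forall i, `|F i| <= 1) ->
  {in s &, forall i j, i != j -> F i = 0 \/ F j = 0} ->
  `|\sum_(i <- s) F i| <= 1.
Proof.
move=> + F1; elim: s => [|i s IH] /=; first by rewrite big_nil normr0.
move=> /andP[si us] Fs; rewrite big_cons.
have [Fi0|Fi0] := eqVneq (F i) 0.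
  rewrite Fi0 add0r; apply: IH => // j k js ks.
  by apply: Fs; rewrite inE ?js ?ks orbT.
rewrite big1_seq ?addr0// => j /= js.
have ij : i != j by apply: contraNneq si => ->.
have jis : j \in i :: s by rewrite inE js orbT.
have [Fi|//] := Fs _ _ (mem_head i s) jis ij.
by rewrite Fi eqxx in Fi0.
Qed.

(** * Sequences that are almost convergent to zero *)

Section BanachSpaces.
Variable R : realType.

Lemma linfty_indic_subproof (A : pred nat) :
  (fun n => (A n)%:R) \in @linfty_pred R.
Proof.
by apply/linfty_predP; exists 1 => n; case: (A n); rewrite ?normr1 ?normr0.
Qed.

(** The indicator sequence of a set of indices. *)
Definition linfty_indic (A : pred nat) : linfty R :=
  Linfty (linfty_indic_subproof A).

(** Evaluation at the index [n], a linear functional on [linfty]. *)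
Definition linfty_coord n (x : linfty R) : R^o := x n.

Lemma linfty_coord_linear n : linear (linfty_coord n).
Proof. by []. Qed.

HB.instance Definition _ n := GRing.isLinear.Build R (linfty R) R^o _
  (linfty_coord n) (linfty_coord_linear n).

Lemma linfty_sumE (I : Type) (s : seq I) (F : I -> linfty R) n :
  (\sum_(i <- s) F i) n = \sum_(i <- s) F i n.
Proof. exact: (linear_sum (linfty_coord n)). Qed.

Lemma linfty_iter_shift k (x : linfty R) n :
  iter k (@linfty_shift R) x n = x (n + k)%N.
Proof. by elim: k n => [|k IH] n /=; rewrite ?addn0// IH addSnnS. Qed.

(** The sum of [N] consecutive shifts of the indicator, taken from index [N] on,
    is at most 1: each window of length [N] beyond [N] contains at most one
    element of [A].  Shift invariance gives [N * B e <= 1] for every [N]. *)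
Lemma lacunary_ac0 (A : pred nat) :
  lacunary A -> linfty_indic A \in @ac0_pred R.
Proof.
move=> lacA; apply/mem_set => B [_ Bge0 B1 BT].
set e := linfty_indic A.
have Biter k (x : linfty R) : B (iter k (@linfty_shift R) x) = B x.
  by elim: k => //= k <-; rewrite BT.
have Be0 : 0 <= B e by apply: Bge0 => n; exact: ler0n.
have BeN N : B e *+ N <= 1.
  pose y := \sum_(i <- iota 0 N) iter i (@linfty_shift R)
              (iter N (@linfty_shift R) e).
  have <- : B y = B e *+ N.
    rewrite linear_sum/= (eq_bigr (fun=> B e)) => [|i _]; last by rewrite !Biter.
    by rewrite big_const_seq count_predT size_iota iter_addr_0.
  rewrite -B1 -subr_ge0 -linearB; apply: Bge0 => n.
  have -> : (linfty1 R - y) n = 1 - y n by [].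
  rewrite subr_ge0 linfty_sumE; apply: le_trans (ler_norm _) _.
  apply: norm_sum_le1; first exact: iota_uniq.
    move=> i; rewrite !linfty_iter_shift/=.
    by case: (A _); rewrite ?normr1 ?normr0.
  move=> i j; rewrite !mem_iota !add0n /= => iN jN ij.
  rewrite !linfty_iter_shift/=.
  have [Ai|_] := boolP (A (n + i + N)%N); last by left.
  have [Aj|_] := boolP (A (n + j + N)%N); last by right.
  (* Both indices lie in [[n + N, n + 2 N[], hence neither is twice the other. *)
  exfalso; case: (ltngtP i j) ij => // ij _.
    have := lacA _ _ Ai Aj; lia.
  have := lacA _ _ Aj Ai; lia.
apply/eqP; rewrite eq_le Be0 andbT leNgt; apply/negP => Be.
have := BeN (Num.truncn (B e)^-1).+1.
rewrite -mulr_natr -ler_pdivlMl// mulr1 leNgt.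
by rewrite truncnS_gt.
Qed.

Lemma finite_support_c0 (x : linfty R) N :
  (forall n, (N <= n)%N -> x n = 0) -> x \in @c0_pred R.
Proof.
move=> xN; apply/mem_set; apply: cvg_near_cst.
by exists N => // n /=; exact: xN.
Qed.

Lemma linfty_tail_subproof N (x : linfty R) :
  (fun n => if (n < N)%N then 0 else x n) \in @linfty_pred R.
Proof.
apply/linfty_predP; exists `|x| => n.
by case: ifP => _; rewrite ?normr0// linfty_norm_ub.
Qed.

(** The sequence [x] with its first [N] entries replaced by 0. *)
Definition linfty_tail N (x : linfty R) : linfty R :=
  Linfty (linfty_tail_subproof N x).

Lemma linfty_tail_c0 N (x : linfty R) : x - linfty_tail N x \in @c0_pred R.
Proof.
apply: (@finite_support_c0 _ N) => n Nn.
have -> : (x - linfty_tail N x) n = x n - linfty_tail N x n by [].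
by rewrite /= ltnNge Nn/= subrr.
Qed.

(** The indicator of a lacunary set, as an element of [ac0]. *)
Definition ac0_indic (A : pred nat) (lacA : lacunary A) : ac0 R :=
  Subspace (lacunary_ac0 lacA).

(** * Bounded functionals that vanish on c0 *)

Section Functional.
Variables (f : {linear ac0 R -> R^o}) (M : R).
Hypothesis fM : forall x : ac0 R, `|x| <= 1 -> `|f x| <= M.
Hypothesis f0 : forall x : c0 R, f (c0_ac0 x) = 0.

(** Such a functional ignores any finite set of coordinates, so it satisfies
    its bound on every [x] whose tail lies in the unit ball. *)
Lemma functional_ess_bound (x : ac0 R) N :
  (forall n, (N <= n)%N -> `|val x n| <= 1) -> `|f x| <= M.
Proof.
move=> xN; pose z : c0 R := Subspace (linfty_tail_c0 N (val x)).
rewrite -[x](subrK (c0_ac0 z)) linearD/= f0 addr0; apply: fM.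
have -> : `|x - c0_ac0 z| = linfty_norm (val (x - c0_ac0 z)) by [].
apply: linfty_norm_le => n.
have -> : val (x - c0_ac0 z) n = val x n - (val x n - linfty_tail N (val x) n).
  by [].
rewrite subKr /=; case: ltnP => nN; last exact: xN.
by rewrite normr0 ler01.
Qed.

Variables (I : choiceType) (A : I -> pred nat).
Hypothesis lacA : forall i, lacunary (A i).
Hypothesis adA : almost_disjoint A.

Lemma functional_sum_bound (s : seq I) : uniq s ->
  \sum_(i <- s) `|f (ac0_indic (@lacA i))| <= M.
Proof.
move=> us; pose a i := ac0_indic (@lacA i).
(* With these signs [f x] is the sum to be bounded, while almost disjointness
   keeps the entries of [x] in [[-1, 1]] from some index on. *)
pose x := \sum_(i <- s) Num.sg (f (a i)) *: a i.
have -> : \sum_(i <- s) `|f (a i)| = f x.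
  by rewrite linear_sum; apply: eq_bigr => i _; rewrite linearZ/= normrEsg.
apply: le_trans (ler_norm _) _.
have /choice[N NA] : forall p : I * I, exists N, p.1 != p.2 ->
    forall n, (N <= n)%N -> ~~ (A p.1 n && A p.2 n).
  move=> [i j] /=.
  have [->|/adA[N NA]] := eqVneq i j; first by exists 0%N.
  by exists N.
apply: (@functional_ess_bound _ (\max_(i <- s) \max_(j <- s) N (i, j))) => n Nn.
have -> : val x n = \sum_(i <- s) Num.sg (f (a i)) * (A i n)%:R.
  rewrite raddf_sum linfty_sumE; exact: eq_bigr.
apply: norm_sum_le1 => // [i|i j si sj ij].
  rewrite normrM normr_sg normr_nat; case: (_ != 0); case: (A i n);
  by rewrite ?mulr1 ?mulr0 ?ler01.
have Nij : (N (i, j) <= n)%N.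
  apply: leq_trans Nn; apply: leq_trans (leq_bigmax_seq _ si _) => //=.
  exact: (@leq_bigmax_seq _ _ _ (fun j => N (i, j)) _ sj).
have := NA (i, j) ij n Nij; rewrite negb_and /= => /orP[Ai|Aj].
  by left; rewrite (negbTE Ai) mulr0.
by right; rewrite (negbTE Aj) mulr0.
Qed.

Lemma functional_support_countable :
  countable [set i | f (ac0_indic (@lacA i)) != 0].
Proof.
(* The set is the union over [k] of the sets where [|f| >= 1 / (k + 1)]; each
   of them has at most [M * (k + 1)] elements. *)
pose S k := [set i | k.+1%:R^-1 <= `|f (ac0_indic (@lacA i))|].
have fS k : finite_set (S k).
  apply: contrapT => /(@infinite_set_fset _ _ (Num.truncn (M * k.+1%:R)).+1).
  move=> [B BS]; apply/negP; rewrite -ltnNge ltnS.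
  have cB : (size (finmap.enum_fset B))%:R <= M * k.+1%:R.
    rewrite -ler_pdivrMr ?ltr0n//.
    apply: le_trans (functional_sum_bound (finmap.fset_uniq B)).
    rewrite mulr_natl -[X in _ *+ X]count_predT -iter_addr_0 -big_const_seq.
    by rewrite big_seq [leRHS]big_seq; apply: ler_sum => i iB; exact: BS.
  by rewrite truncn_ge_nat// (le_trans _ cB).
apply: sub_countable (_ : countable (\bigcup_k S k)).
  apply: subset_card_le => i /= fi.
  exists (Num.truncn `|f (ac0_indic (@lacA i))|^-1) => //.
  by rewrite /S/= invf_ple ?posrE ?normr_gt0 ?ltr0n// ltW// truncnS_gt.
by apply: bigcup_countable => // k _; exact: finite_set_countable.
Qed.

End Functional.

(** * Coordinates of the complementary projection *)

Section Residual.
Variable P : {linear ac0 R -> c0 R}.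

(** The [n]-th coordinate of [x - P x], a functional that vanishes on [c0] when
    [P] is a projection onto [c0]. *)
Definition residual n (x : ac0 R) : R^o := val x n - val (P x) n.

Lemma residual_linear n : linear (residual n).
Proof.
move=> a x y; rewrite /residual.
have linE (u v : linfty R) : (a *: u + v) n = a * u n + v n by [].
have -> : val (a *: x + y) = a *: val x + val y by exact: linearP.
have -> : val (P (a *: x + y)) = a *: val (P x) + val (P y).
  by rewrite [P _]linearP; exact: linearP.
by rewrite !linE opprD addrACA -mulrBr.
Qed.

HB.instance Definition _ n := GRing.isLinear.Build R (ac0 R) R^o _
  (residual n) (residual_linear n).

End Residual.

Lemma prefix_set_not_c0 t : linfty_indic (prefix_set t) \notin @c0_pred R.
Proof.
apply/negP => /set_mem /= /cvgrPdist_lt /(_ 1 ltr01)[N _ eN].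
have /= := eN (prefix_code t N) _; rewrite prefix_set_code sub0r normrN normr1.
rewrite ltxx => /(_ _)/negP; apply => //=.
have /andP[+ _] := prefix_code_bounds t N.
by apply: leq_trans; exact/ltnW/ltn_expl.
Qed.

End BanachSpaces.

Theorem theorem2p3 (R : realType) :
  ~ exists P : {linear ac0 R -> c0 R},
      bounded_fun_norm P /\ forall x : c0 R, P (c0_ac0 x) = x.
Proof.
move=> [P [/(_ 1)[M PM] Pid]].
pose a t : ac0 R := ac0_indic R (@lacunary_prefix_set t).
pose S n := [set t | residual P n (a t) != 0].
have cS n : countable (S n).
  apply: (@functional_support_countable R (residual P n) (1 + M) _ _ _ prefix_set).
  - move=> x x1; apply: le_trans (ler_normB _ _) _; apply: lerD.
      exact: le_trans (linfty_norm_ub _ _) x1.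
    exact: le_trans (linfty_norm_ub _ _) (PM _ x1).
  - by move=> x; rewrite /= /residual Pid; exact: subrr.
  - exact: almost_disjoint_prefix_set.
have [t tS] : exists t, forall n, ~ S n t.
  apply: contrapT => noS; apply: uncountable_binary_sequences.
  apply: sub_countable (_ : countable (\bigcup_n S n)).
    apply: subset_card_le => t _; apply: contrapT => tS; apply: noS.
    by exists t => n tn; apply: tS; exists n.
  exact: bigcup_countable.
suff aE : val (a t) = val (P (a t)).
  by have := valP (P (a t)); rewrite -aE (negbTE (prefix_set_not_c0 R t)).
apply/val_inj/funext => n; apply/eqP; rewrite -subr_eq0.
by apply/negPn/negP; exact: tS.
Qed.
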